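(* Let $R$ be any ring, let $(\mathcal{L},\mathcal{A})$ be a complete duality pair over $R$, let $\mathcal{GP}$ be the class of Gorenstein $(\mathcal{L},\mathcal{A})$-projective left $R$-modules and let $\mathcal{F}$ be the class of flat left $R$-modules. The following conditions are equivalent. (1) $(\mathcal{GP},\mathcal{F})$ is a strong left Frobenius pair (in $R$-Mod). (2) $(\mathcal{GP},\mathcal{F})$ is a left Frobenius pair (in $R$-Mod). (3) $R$ is a left perfect ring, i.e. every flat left $R$-module is projective.
   Context: $R$ is an associative ring with identity; modules are left $R$-modules unless stated otherwise. For a module $M$, $M^+=\mathrm{Hom}_{\mathbb{Z}}(M,\mathbb{Q}/\mathbb{Z})$ is its character module (on the opposite side). Duality pairs: a duality pair over $R$ is a pair $(\mathcal{L},\mathcal{A})$, with $\mathcal{L}$ a class of left (resp. right) $R$-modules and $\mathcal{A}$ a class of right (resp. left) $R$-modules, such that $L\in\mathcal{L}$ if and only if $L^+\in\mathcal{A}$, and $\mathcal{A}$ is closed under direct summands and finite direct sums. With $\mathcal{L}$ a class of left modules, $(\mathcal{L},\mathcal{A})$ is perfect if $\mathcal{L}$ contains ${}_RR$ and is closed under coproducts and extensions. $(\mathcal{L},\mathcal{A})$ is complete if it is a perfect duality pair and $(\mathcal{A},\mathcal{L})$ is also a duality pair. Classes of modules are closed under isomorphism. Here $\mathcal{L}$ consists of left modules and $\mathcal{A}$ of right modules. A sequence is $\mathrm{Hom}_R(-,\mathcal{L})$-exact if it remains exact after applying $\mathrm{Hom}_R(-,L)$ for every $L\in\mathcal{L}$.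 A left $R$-module $M$ is Gorenstein $(\mathcal{L},\mathcal{A})$-projective if there is a $\mathrm{Hom}_R(-,\mathcal{L})$-exact exact sequence $\cdots\to P_1\to P_0\to P_{-1}\to P_{-2}\to\cdots$ with each $P_i$ projective such that $M\cong\mathrm{Ker}(P_{-1}\to P_{-2})$. Frobenius pairs: let $\mathcal{X},\omega$ be classes of objects in an abelian category. $\mathcal{X}$ is left thick if it is closed under direct summands, extensions and kernels of epimorphisms (between objects of $\mathcal{X}$). $\omega$ is $\mathcal{X}$-injective if $\mathrm{Ext}^j(X,W)=0$ for all $X\in\mathcal{X}$, $W\in\omega$, $j\geq1$; it is $\mathcal{X}$-projective if $\mathrm{Ext}^j(W,X)=0$ for all such $X,W,j$. $\omega$ is a relative cogenerator in $\mathcal{X}$ if $\omega\subseteq\mathcal{X}$ and each $X\in\mathcal{X}$ admits a short exact sequence $0\to X\to W\to X'\to0$ with $W\in\omega$, $X'\in\mathcal{X}$; it is a relative generator in $\mathcal{X}$ if $\omega\subseteq\mathcal{X}$ and each $X\in\mathcal{X}$ admits a short exact sequence $0\to X'\to W\to X\to0$ with $W\in\omega$, $X'\in\mathcal{X}$. $(\mathcal{X},\omega)$ is a left Frobenius pair if $\mathcal{X}$ is left thick, $\omega$ is an $\mathcal{X}$-injective relative cogenerator in $\mathcal{X}$, and $\omega$ is closed under direct summands. It is strong if moreover $\omega$ is an $\mathcal{X}$-projective relative generator in $\mathcal{X}$. *)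

(* Defs.v *)
From HB Require Import structures.
From mathcomp Require Import all_boot all_order all_algebra.
From mathcomp Require Import boolp.
From mathcomp Require Import freeg.

Set Implicit Arguments.
Unset Strict Implicit.
Unset Printing Implicit Defensive.

Import GRing.Theory.

Local Open Scope ring_scope.
Local Open Scope quotient_scope.

(** A left module over [R : pzRingType] is an [lmodType R]; a right module is
    an [lmodType R^c], where [R^c] is the opposite ring, so that [r *: m] with
    [r : R^c] stands for m r. *)

Definition lmod_class (R : pzRingType) := lmodType R -> Prop.

Section Sequences.
Variable R : pzRingType.
Implicit Types A B C M N P : lmodType R.

Definition isomorphic M N := exists f : {linear M -> N}, bijective f.

Definition projective P :=
  forall M N (g : {linear M -> N}) (f : {linear P -> N}),
    (forall y, exists x, g x = y) ->
    exists h : {linear P -> M}, forall x, g (h x) = f x.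

(** [Hom(C, N) -> Hom(B, N) -> Hom(A, N)] is exact at [Hom(B, N)]. *)
Definition Hom_exact A B C (f : {linear A -> B}) (g : {linear B -> C}) N :=
  forall phi : {linear B -> N},
    (forall x, phi (f x) = 0) <->
    exists psi : {linear C -> N}, forall y, psi (g y) = phi y.

Definition is_kernel M A B (i : {linear M -> A}) (f : {linear A -> B}) :=
  injective i /\ forall x, f x = 0 <-> exists m, i m = x.

Definition is_coproduct (I : Type) (M : I -> lmodType R) C
    (inj : forall i, {linear M i -> C}) :=
  forall N (f : forall i, {linear M i -> N}),
    exists g : {linear C -> N},
      (forall i x, g (inj i x) = f i x) /\
      forall g' : {linear C -> N},
        (forall i x, g' (inj i x) = f i x) -> g' =1 g.

End Sequences.

(** Exactness only involves the additive structure; it is used both for modules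
    and for the abelian groups obtained by tensoring. *)
Definition exact_at (A B C : zmodType) (f : A -> B) (g : B -> C) :=
  forall y, g y = 0 <-> exists x, f x = y.

Definition short_exact (A B C : zmodType) (f : A -> B) (g : B -> C) :=
  [/\ injective f, exact_at f g & forall z, exists y, g y = z].

Section Closure.
Variable R : pzRingType.
Implicit Types X : lmod_class R.

Definition iso_closed X := forall M N, isomorphic M N -> X M -> X N.

Definition summand_closed X :=
  forall M N N' : lmodType R, isomorphic M (N * N')%type -> X M -> X N.

Definition coproduct_closed X :=
  forall (I : Type) (M : I -> lmodType R) (C : lmodType R)
    (inj : forall i, {linear M i -> C}),
    is_coproduct inj -> (forall i, X (M i)) -> X C.

(** The empty direct sum is included. *)
Definition finite_sum_closed X :=
  forall (I : finType) (M : I -> lmodType R) (C : lmodType R)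
    (inj : forall i, {linear M i -> C}),
    is_coproduct inj -> (forall i, X (M i)) -> X C.

Definition extension_closed X :=
  forall (A B C : lmodType R) (f : {linear A -> B}) (g : {linear B -> C}),
    short_exact f g -> X A -> X C -> X B.

Definition epikernel_closed X :=
  forall (A B C : lmodType R) (f : {linear A -> B}) (g : {linear B -> C}),
    short_exact f g -> X B -> X C -> X A.

End Closure.

Definition QmodZ : zmodType :=
  Quotient.quot (GRing.ZmodClosed.clone rat (@Num.int_num_subdef rat) _).

Definition char (M : zmodType) : Type := {additive M -> QmodZ}.

HB.instance Definition _ M := gen_eqMixin (char M).
HB.instance Definition _ M := gen_choiceMixin (char M).

Section CharGroup.
Variable M : zmodType.
Implicit Types f g h : char M.

Definition char_fun f : M -> QmodZ := (f : {additive M -> QmodZ}).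

Lemma charP f g : char_fun f =1 char_fun g -> f = g.
Proof.
case: f g => [f [[cf]]] [g [[cg]]] /funext /= efg.
by rewrite /char_fun /= in efg; subst g; rewrite (Prop_irrelevance cf cg).
Qed.

Definition char_zero : char M := (\0 : M -> QmodZ).
Definition char_opp f : char M := (\- (char_fun f)).
Definition char_add f g : char M := (char_fun f \+ char_fun g).

Fact char_addA : associative char_add.
Proof. by move=> f g h; apply: charP => x; apply: addrA. Qed.
Fact char_addC : commutative char_add.
Proof. by move=> f g; apply: charP => x; apply: addrC. Qed.
Fact char_add0 : left_id char_zero char_add.
Proof. by move=> f; apply: charP => x; apply: add0r. Qed.
Fact char_addN : left_inverse char_zero char_opp char_add.
Proof. by move=> f; apply: charP => x; apply: addNr. Qed.

HB.instance Definition _ :=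
  GRing.isZmodule.Build (char M) char_addA char_addC char_add0 char_addN.

End CharGroup.

Section CharScale.
Variables (S : pzRingType) (M : lmodType S).

Definition char_scale (r : S) (f : char M) : char M :=
  (char_fun f \o *:%R r).

Fact char_scaleE r f x : char_fun (char_scale r f) x = char_fun f (r *: x).
Proof. by []. Qed.

Fact char_scale1 f : char_scale 1 f = f.
Proof. by apply: charP => x; rewrite char_scaleE scale1r. Qed.
Fact char_scaleM r s f :
  char_scale r (char_scale s f) = char_scale (s * r) f.
Proof. by apply: charP => x; rewrite !char_scaleE scalerA. Qed.
Fact char_scaleDr r : {morph char_scale r : f g / f + g}.
Proof. by move=> f g; apply: charP. Qed.
Fact char_scaleDl f : {morph char_scale^~ f : r s / r + s}.
Proof.
move=> r s; apply: charP => x; rewrite char_scaleE scalerDl.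
exact: raddfD.
Qed.

End CharScale.

Section CharModules.
Variable R : pzRingType.

(** For a left module [M], [M^+] is a right module through (f r)(x) = f(r x). *)
Definition lchar_type (M : lmodType R) : Type := char M.
HB.instance Definition _ M := GRing.Zmodule.on (lchar_type M).
HB.instance Definition _ M :=
  @GRing.Zmodule_isLmodule.Build R^c (lchar_type M) (@char_scale R M)
    (@char_scaleM R M) (@char_scale1 R M)
    (@char_scaleDr R M) (@char_scaleDl R M).
Definition lchar (M : lmodType R) : lmodType R^c := lchar_type M.

(** For a right module [N], [N^+] is a left module through (r f)(x) = f(x r). *)
Definition rchar_type (N : lmodType R^c) : Type := char N.
HB.instance Definition _ N := GRing.Zmodule.on (rchar_type N).
HB.instance Definition _ N :=
  @GRing.Zmodule_isLmodule.Build R (rchar_type N) (@char_scale R^c N)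
    (@char_scaleM R^c N) (@char_scale1 R^c N)
    (@char_scaleDr R^c N) (@char_scaleDl R^c N).
Definition rchar (N : lmodType R^c) : lmodType R := rchar_type N.

Lemma lcharZ M (r : R^c) (f : lchar M) x :
  char_fun (r *: f : lchar M) x = char_fun f ((r : R) *: x).
Proof. by []. Qed.

Lemma rcharZ N (r : R) (f : rchar N) x :
  char_fun (r *: f : rchar N) x = char_fun f ((r : R^c) *: x).
Proof. by []. Qed.

End CharModules.

(** [S] and [T] are opposite rings and [ch] is the character module functor. *)
Definition gen_duality_pair (S T : pzRingType) (ch : lmodType S -> lmodType T)
    (X : lmod_class S) (Y : lmod_class T) :=
  [/\ iso_closed X, iso_closed Y,
      forall M, X M <-> Y (ch M),
      summand_closed Y & finite_sum_closed Y].

Section DualityPairs.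
Variable R : pzRingType.
Implicit Types (L : lmod_class R) (A : lmod_class R^c).

(** The two sides differ: [duality_pair] has the left modules first,
    [duality_pair_op] the right modules. *)
Definition duality_pair L A := gen_duality_pair (@lchar R) L A.

Definition duality_pair_op A L := gen_duality_pair (@rchar R) A L.

Definition perfect_duality_pair L A :=
  [/\ duality_pair L A, L R^o, coproduct_closed L & extension_closed L].

Definition complete_duality_pair L A :=
  perfect_duality_pair L A /\ duality_pair_op A L.

End DualityPairs.

Section Tensor.
Variables (R : pzRingType) (A : lmodType R^c) (M : lmodType R).

Let F := {freeg (A * M) / int}.

(** The subgroup of the free abelian group on [A * M] generated by the
    bilinearity and balancing relations. *)
Inductive tensor_rel : F -> Prop :=
| tensor_rel0 : tensor_rel 0
| tensor_relB x y : tensor_rel x -> tensor_rel y -> tensor_rel (x - y)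
| tensor_relDl a a' m :
    tensor_rel (<< (a + a', m) >> - << (a, m) >> - << (a', m) >>)
| tensor_relDr a m m' :
    tensor_rel (<< (a, m + m') >> - << (a, m) >> - << (a, m') >>)
| tensor_relZ (r : R) a m :
    tensor_rel (<< ((r : R^c) *: a, m) >> - << (a, r *: m) >>).

Definition tensor_rel_pred : pred F := fun x => `[< tensor_rel x >].

Fact tensor_rel_closed : zmod_closed tensor_rel_pred.
Proof.
split=> [|x y /asboolP rx /asboolP ry]; apply/asboolP.
  exact: tensor_rel0.
exact: tensor_relB.
Qed.

HB.instance Definition _ :=
  GRing.isZmodClosed.Build F tensor_rel_pred tensor_rel_closed.

Definition tensor : zmodType :=
  Quotient.quot (GRing.ZmodClosed.clone F tensor_rel_pred _).

Definition tens (a : A) (m : M) : tensor := \pi_tensor << (a, m) >>.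

Definition balanced (V : zmodType) (b : A -> M -> V) :=
  [/\ forall a a' m, b (a + a') m = b a m + b a' m,
      forall a m m', b a (m + m') = b a m + b a m' &
      forall (r : R) a m, b ((r : R^c) *: a) m = b a (r *: m)].

Lemma tens_balanced : balanced tens.
Proof.
rewrite /tens; split=> [a a' m|a m m'|r a m]; apply/eqP.
- rewrite -raddfD -Quotient.idealrBE opprD addrA; apply/asboolP.
  exact: tensor_relDl.
- rewrite -raddfD -Quotient.idealrBE opprD addrA; apply/asboolP.
  exact: tensor_relDr.
- by rewrite -Quotient.idealrBE; apply/asboolP; apply: tensor_relZ.
Qed.

Section Lift.
Variables (V : zmodType) (b : A -> M -> V).

Let lift0 : F -> V := fglift (fun p : A * M => b p.1 p.2 : zmodule V).

Let lift0B x y : lift0 (x - y) = lift0 x - lift0 y.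
Proof. exact: (lift_is_additive (fun p : A * M => b p.1 p.2 : zmodule V)). Qed.

Let lift0U p : lift0 << p >> = b p.1 p.2.
Proof. by rewrite /lift0 liftU scale1r. Qed.

Definition tensor_lift (t : tensor) : V := lift0 (repr t).

Hypothesis b_balanced : balanced b.

Let lift0_rel x : tensor_rel x -> lift0 x = 0.
Proof.
case: b_balanced => bDl bDr bZ; elim=> {x} [|x y _ x0 _ y0|a a' m|a m m'|r a m].
- by rewrite -[X in lift0 X](subrr 0) lift0B subrr.
- by rewrite lift0B x0 y0 subrr.
- by rewrite !lift0B !lift0U /= bDl addrAC addrK subrr.
- by rewrite !lift0B !lift0U /= bDr addrAC addrK subrr.
- by rewrite !lift0B !lift0U /= bZ subrr.
Qed.

Let lift0_pi x : tensor_lift (\pi x) = lift0 x.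
Proof.
apply/eqP; rewrite -subr_eq0 -lift0B; apply/eqP/lift0_rel/asboolP.
have : repr (\pi_tensor x) == x %[mod tensor] by rewrite reprK.
by rewrite -Quotient.idealrBE.
Qed.

Lemma tensor_lift_tens a m : tensor_lift (tens a m) = b a m.
Proof. by rewrite lift0_pi lift0U. Qed.

Lemma tensor_liftB : {morph tensor_lift : x y / x - y}.
Proof.
move=> x y; rewrite -[x]reprK -[y]reprK -raddfB !lift0_pi; exact: lift0B.
Qed.

End Lift.

Lemma tensor_ext (V : zmodType) (f g : {additive tensor -> V}) :
  (forall a m, f (tens a m) = g (tens a m)) -> f =1 g.
Proof.
move=> fg x; rewrite -[x]reprK -[repr x]freeg_sumE !raddf_sum.
apply: eq_bigr => -[a m] _.
rewrite -[coeff _ _]intz -freegU_mulz !raddfMz.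
by congr (_ *~ _); apply: fg.
Qed.

End Tensor.

Definition tensor_map (R : pzRingType) (A B : lmodType R^c) (M : lmodType R)
    (f : {linear A -> B}) : tensor A M -> tensor B M :=
  tensor_lift (fun a m => tens (f a) m).
Arguments tensor_map {R A B} M f.

Lemma tensor_map_balanced (R : pzRingType) (A B : lmodType R^c)
    (M : lmodType R) (f : {linear A -> B}) :
  balanced (fun a (m : M) => tens (f a) m).
Proof.
have [tDl tDr tZ] := tens_balanced B M.
split=> [a a' m|a m m'|r a m]; first by rewrite raddfD tDl.
  exact: tDr.
by rewrite linearZ tZ.
Qed.

Lemma tensor_map_tens (R : pzRingType) (A B : lmodType R^c) (M : lmodType R)
    (f : {linear A -> B}) a (m : M) :
  tensor_map M f (tens a m) = tens (f a) m.
Proof. exact: (tensor_lift_tens (@tensor_map_balanced R A B M f)). Qed.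

HB.instance Definition _ (R : pzRingType) (A B : lmodType R^c)
    (M : lmodType R) (f : {linear A -> B}) :=
  GRing.isZmodMorphism.Build (tensor A M) (tensor B M) (tensor_map M f)
    (tensor_liftB (@tensor_map_balanced R A B M f)).

Section Modules.
Variable R : pzRingType.
Implicit Types X W L : lmod_class R.

Definition flat : lmod_class R := fun M =>
  forall (A B C : lmodType R^c) (f : {linear A -> B}) (g : {linear B -> C}),
    short_exact f g -> short_exact (tensor_map M f) (tensor_map M g).

Definition left_perfect := forall M, flat M -> projective M.

(** Depends on the pair through [L] only.  The term of index -1 is written
    [P (1 + (-2))], to which it is convertible; indexing the differentials by
    their target avoids transports between [P i] and [P j] for [i = j]. *)
Definition gorenstein_projective L : lmod_class R := fun M =>
  exists (P : int -> lmodType R) (d : forall i, {linear P (1 + i) -> P i}),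
    [/\ forall i, projective (P i),
        forall i, exact_at (d (1 + i)) (d i),
        forall i N, L N -> Hom_exact (d (1 + i)) (d i) N &
        exists iota : {linear M -> P (1 + (-2))}, is_kernel iota (d (-2))].

Definition projective_resolution (M : lmodType R) (P : nat -> lmodType R)
    (d : forall n, {linear P n.+1 -> P n}) (eps : {linear P 0%N -> M}) :=
  [/\ forall n, projective (P n),
      forall n, exact_at (d n.+1) (d n),
      exact_at (d 0%N) eps &
      forall x, exists y, eps y = x].

(** [Ext^n(M, N) = 0], where [Ext^n(M, N)] is the [n]-th cohomology of
    [Hom(P, N)], for [P] any projective resolution of [M]. *)
Definition Ext_vanishes (n : nat) (M N : lmodType R) :=
  if n is k.+1 then
    forall P d eps, @projective_resolution M P d eps ->
      Hom_exact (d k.+1) (d k) N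
  else forall (f : {linear M -> N}) x, f x = 0.

Definition left_thick X :=
  [/\ summand_closed X, extension_closed X & epikernel_closed X].

Definition rel_injective X W :=
  forall M N n, (0 < n)%N -> X M -> W N -> Ext_vanishes n M N.

Definition rel_projective X W :=
  forall M N n, (0 < n)%N -> X M -> W N -> Ext_vanishes n N M.

Definition rel_cogenerator X W :=
  (forall M, W M -> X M) /\
  forall M, X M -> exists (N M' : lmodType R)
    (f : {linear M -> N}) (g : {linear N -> M'}),
    [/\ short_exact f g, W N & X M'].

Definition rel_generator X W :=
  (forall M, W M -> X M) /\
  forall M, X M -> exists (M' N : lmodType R)
    (f : {linear M' -> N}) (g : {linear N -> M}),
    [/\ short_exact f g, W N & X M'].

Definition left_frobenius_pair X W :=
  [/\ left_thick X, rel_injective X W, rel_cogenerator X W & summand_closed W].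

Definition strong_left_frobenius_pair X W :=
  [/\ left_frobenius_pair X W, rel_projective X W & rel_generator X W].

End Modules.

(* Main.v *)
(** A module is Gorenstein projective iff it lies in a class all of whose members
    X satisfy Ext^1(X, L) = 0 and admit both a syzygy and a cosyzygy in the class.
    Closure of GP under extensions, retracts and kernels of epimorphisms is then
    obtained by exhibiting such classes, using that L contains the projectives.
    If flat modules are projective, these closures give a strong Frobenius pair.
    Conversely, let M be flat and 0 -> K -> P -> M -> 0 exact with P free. Then K
    is flat and M is in GP, so Ext^1(M, K) = 0; the sequence splits and M is
    projective. *)
From HB Require Import structures.
From mathcomp Require Import all_boot all_order all_algebra.
From mathcomp Require Import boolp functions.
Require Import Defs.

Set Implicit Arguments.
Unset Strict Implicit.
Unset Printing Implicit Defensive.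

Import GRing.Theory.
Local Open Scope ring_scope.
Local Open Scope quotient_scope.

(** [Ext_vanishes] quantifies over all projective resolutions, which is awkward both to use and to
    prove. [ext1_vanishes] replaces it by the extension of maps along short exact sequences, a form
    that passes to extensions and retracts by pullback; higher Ext reduces to it in a class closed
    under syzygies. Closure of GP under kernels of epimorphisms rests on closure under retracts,
    through Schanuel's lemma, so extensions and retracts have to be settled before it. Closure of L
    under summands is not among the axioms, so that L contains every projective is read off on
    character modules, where A is closed under summands. Flatness of K is obtained by diagram chases
    instead of Tor: dual bases give injectivity after tensoring with a free or projective module,
    and a free presentation of the other factor does the rest. *)

(** * Factorizations, kernels and cokernels of linear maps *)

Lemma dependent_choice_fun (I : Type) (F : I -> Type) (S : forall i, F i -> Prop) :
  (forall i, exists x, S i x) -> exists f, forall i, S i (f i).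
Proof. by move=> FS; exists (fun i => sval (cid (FS i))) => i; apply: svalP. Qed.

Definition linear_of (R : pzRingType) (A B : lmodType R) (f : A -> B)
    (fL : linear f) : {linear A -> B} :=
  HB.pack f (GRing.isLinear.Build R A B *:%R f fL).

Section Factor.
Variables (R : pzRingType) (A B C : lmodType R).

Lemma factor_epi (q : {linear A -> B}) (f : {linear A -> C}) :
    (forall y, exists x, q x = y) -> (forall x, q x = 0 -> f x = 0) ->
  exists g : {linear B -> C}, forall x, g (q x) = f x.
Proof.
move=> /choice[s qs] f0.
have fsq x : f (s (q x)) = f x.
  by apply/eqP; rewrite -subr_eq0 -linearB f0 // linearB qs subrr.
suff gL : linear (f \o s) by exists (linear_of gL).
move=> a x y /=; rewrite -linearP -[LHS]fsq -[RHS]fsq.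
by rewrite qs linearP !qs.
Qed.

Lemma factor_mono (i : {linear B -> C}) (f : {linear A -> C}) :
    injective i -> (forall x, exists y, i y = f x) ->
  exists g : {linear A -> B}, forall x, i (g x) = f x.
Proof.
move=> i_inj /choice[g gP].
suff gL : linear g by exists (linear_of gL).
by move=> a x y; apply: i_inj; rewrite linearP !gP linearP.
Qed.

End Factor.

Lemma mono_of_ker (R : pzRingType) (A B : lmodType R) (f : {linear A -> B}) :
  (forall x, f x = 0 -> x = 0) -> injective f.
Proof.
by move=> f0 x y fxy; apply/eqP; rewrite -subr_eq0; apply/eqP/f0;
  rewrite linearB fxy subrr.
Qed.

Lemma mono_eq0 (U V : zmodType) (f : {additive U -> V}) x :
  injective f -> f x = 0 -> x = 0.
Proof. by move=> fI fx0; apply: fI; rewrite fx0 raddf0. Qed.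

Section Kernel.
Variables (R : pzRingType) (A B : lmodType R) (f : {linear A -> B}).

Definition ker_pred : pred A := fun x => f x == 0.

Fact ker_submod_closed : submod_closed ker_pred.
Proof.
split=> [|a x y]; rewrite !unfold_in ?raddf0 // => /eqP fx0 /eqP fy0.
by rewrite linearP fx0 fy0 scaler0 addr0.
Qed.
HB.instance Definition _ := GRing.isSubmodClosed.Build R A ker_pred ker_submod_closed.

Record ker_mod := KerMod { ker_val :> A ; ker_valP : ker_val \in ker_pred }.
HB.instance Definition _ := [isSub for ker_val].
HB.instance Definition _ := [Choice of ker_mod by <:].
HB.instance Definition _ := [SubChoice_isSubLmodule of ker_mod by <:].

Lemma kernel_exists : exists (K : lmodType R) (k : {linear K -> A}), is_kernel k f.
Proof.
exists ker_mod, (val : {linear ker_mod -> A}); split=> [|x]; first exact: val_inj.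
split=> [fx0|[m <-]]; last by apply/eqP; case: m.
have xK : x \in ker_pred by apply/eqP.
by exists (KerMod xK).
Qed.

End Kernel.

Lemma zquotient_exists (V : zmodType) (S : {pred V}) :
    zmod_closed S ->
  exists (Q : zmodType) (p : {additive V -> Q}),
    (forall y, exists x, p x = y) /\ forall x, p x = 0 <-> x \in S.
Proof.
move=> S_closed.
pose SV : zmodClosed V := HB.pack S (GRing.isZmodClosed.Build V S S_closed).
exists (Quotient.quot SV), (\pi_(Quotient.quot SV)).
split=> [y|x]; first by exists (repr y); apply: reprK.
rewrite -[x in x \in S]subr0 (Quotient.idealrBE SV).
rewrite -(raddf0 (\pi_(Quotient.quot SV))).
by split=> [->|/eqP].
Qed.

(** Turns membership in an image into the vanishing of an additive map, which on a tensor product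
    can be checked on pure tensors. *)
Lemma zcokernel_exists (U V : zmodType) (f : {additive U -> V}) :
  exists (Q : zmodType) (p : {additive V -> Q}),
    exact_at f p /\ forall y, exists x, p x = y.
Proof.
have [|Q [p [pS pE]]] := @zquotient_exists V (fun y => `[< exists x, f x = y >]).
  split=> [|_ _ /asboolP[x <-] /asboolP[y <-]]; apply/asboolP.
    by exists 0; rewrite raddf0.
  by exists (x - y); rewrite raddfB.
by exists Q, p; split=> // y; apply: (iff_trans (pE y)); split=> /asboolP.
Qed.

Lemma cokernel_exists (R : pzRingType) (A B : lmodType R) (f : {linear A -> B}) :
  exists (C : lmodType R) (g : {linear B -> C}),
    exact_at f g /\ forall z, exists y, g y = z.
Proof.
have [[Q Qc] [p [pP p_surj]]] := zcokernel_exists f.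
have [s sK] := choice p_surj.
(* The section [s] is only a function; [scaleE] shows that the action does not depend on it, because
   the image of [f] is stable under scalars. *)
pose scale a z := p (a *: s z).
have scaleE a y : scale a (p y) = p (a *: y).
  apply/eqP; rewrite -subr_eq0 -raddfB -scalerBr; apply/eqP/pP.
  have /pP[x xE] : p (s (p y) - y) = 0 by rewrite raddfB sK subrr.
  by exists (a *: x); rewrite -xE; exact: (linearZZ f).
have scaleA a b z : scale a (scale b z) = scale (a * b) z.
  by rewrite [scale b z]/scale scaleE scalerA.
have scale1 : left_id 1 scale by move=> z; rewrite /scale scale1r sK.
have scaleDr : right_distributive scale +%R.
  by move=> a x y; rewrite -(sK x) -(sK y) -raddfD !scaleE scalerDr raddfD.
have scaleDl z : {morph scale^~ z : a b / a + b}.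
  by move=> a b; rewrite /scale scalerDl raddfD.
pose C : lmodType R := HB.pack Q
  Qc (GRing.Zmodule_isLmodule.Build R (GRing.Zmodule.Pack Qc)
        scaleA scale1 scaleDr scaleDl).
have pL : linear (p : B -> C).
  by move=> a x y; rewrite raddfD -scaleE.
by exists C, (linear_of pL).
Qed.

Lemma short_exact_cokernel (R : pzRingType) (A B : lmodType R) (f : {linear A -> B}) :
  injective f -> exists (C : lmodType R) (g : {linear B -> C}), short_exact f g.
Proof. by move=> f_inj; have [C [g [fg gS]]] := cokernel_exists f; exists C, g. Qed.

Lemma short_exact_kernel (R : pzRingType) (B C : lmodType R) (g : {linear B -> C}) :
    (forall z, exists y, g y = z) ->
  exists (A : lmodType R) (f : {linear A -> B}), short_exact f g.
Proof. by move=> gS; have [A [f [fI fg]]] := kernel_exists g; exists A, f. Qed.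

Definition pairL (R : pzRingType) (Z A B : lmodType R) (f : {linear Z -> A})
    (g : {linear Z -> B}) : {linear Z -> (A * B)%type}.
Proof.
by apply: (@linear_of _ _ _ (fun z => (f z, g z))) => a x y; rewrite !linearP.
Defined.

Definition copairL (R : pzRingType) (A B Z : lmodType R) (f : {linear A -> Z})
    (g : {linear B -> Z}) : {linear (A * B)%type -> Z} := (f \o fst) \+ (g \o snd).

Lemma projective_prod (R : pzRingType) (P Q : lmodType R) :
  projective P -> projective Q -> projective (P * Q)%type.
Proof.
move=> projP projQ M N g f gS.
have [h hE] := projP M N g (f \o pairL idfun \0) gS.
have [k kE] := projQ M N g (f \o pairL \0 idfun) gS.
exists (copairL h k) => -[x y] /=.
rewrite linearD hE kE /= -linearD; congr (f _).
by rewrite /GRing.add /= /add_pair /= addr0 add0r.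
Qed.

Lemma short_exact0 (U V W : zmodType) (f : U -> V) (g : V -> W) x :
  short_exact f g -> g (f x) = 0.
Proof. by case=> _ fg _; apply/fg; exists x. Qed.

(** * Vanishing of Ext^1 as extension of maps, and dimension shifting *)

Section Ext1.
Variable R : pzRingType.
Implicit Types A B C K M N P X : lmodType R.

(** Ext^1(X, N) = 0 read off the long exact sequence: Hom(B, N) -> Hom(A, N) is onto for every
    extension B of X by A. *)
Definition ext1_vanishes X N :=
  forall A B (i : {linear A -> B}) (p : {linear B -> X}), short_exact i p ->
  forall phi : {linear A -> N}, exists psi : {linear B -> N},
    forall a, psi (i a) = phi a.

(** Every extension B of X is a pushout of the given presentation: a lift [h] of [p] makes P (+) A
    -> B onto, with kernel the pairs (i k, - h' k), and on these the maps chosen on P and on A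
    cancel. *)
Lemma ext1_vanishes_presentation K P X N
    (i : {linear K -> P}) (p : {linear P -> X}) :
    projective P -> short_exact i p ->
    (forall phi : {linear K -> N}, exists psi : {linear P -> N},
       forall a, psi (i a) = phi a) ->
  ext1_vanishes X N.
Proof.
move=> projP [iI ip pS] extP A B j q [jI jq qS] phi.
have [h hE] := projP B X q p qS.
have [h' h'E] : exists h' : {linear K -> A}, forall x, j (h' x) = h (i x).
  apply: (factor_mono (f := h \o i) jI) => x /=.
  by apply/jq; rewrite hE; apply/ip; exists x.
have [psi psiE] := extP (phi \o h').
have [||g gE] := factor_epi (q := copairL h j) (f := copairL psi phi).
- move=> b; have [x xE] := pS (q b).
  have /jq[a aE] : q (b - h x) = 0 by rewrite linearB hE xE subrr.
  by exists (x, a); rewrite /= aE addrC subrK.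
- move=> [x a] /= hja0.
  have /ip[k kE] : p x = 0.
    rewrite -hE -[RHS](linear0 q) -hja0 linearD [q (j a)](jq _).2 ?addr0 //.
    by exists a.
  have -> : a = - h' k.
    by apply: jI; rewrite linearN h'E kE; apply/eqP; rewrite -addr_eq0 addrC hja0.
  by rewrite linearN -kE psiE /= subrr.
by exists g => a; have := gE (0, a); rewrite /= !linear0 !add0r.
Qed.

(** The map is extended in two stages: from X to the kernel Z of Y -> B -> C, where Z / X is A, then
    from Z to Y, where Y / Z is C. *)
Lemma ext1_vanishes_extension A B C N (f : {linear A -> B}) (g : {linear B -> C}) :
  short_exact f g -> ext1_vanishes A N -> ext1_vanishes C N -> ext1_vanishes B N.
Proof.
move=> [fI fg gS] EA EC X Y i p [iI ip pS] phi.
have [|Z [k kgp]] := @short_exact_kernel _ _ _ (g \o p).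
  by move=> z; have [b <-] := gS z; have [y <-] := pS b; exists y.
have [kI kg _] := kgp.
have [i' i'E] := factor_mono kI (f := i) (fun x => (kg (i x)).1 (etrans
  (congr1 g ((ip _).2 (ex_intro _ x erefl))) (linear0 g))).
have [|p' p'E] := factor_mono fI (f := p \o k).
  by move=> z; apply/fg/(kg (k z)); exists z.
have ip' : short_exact i' p'.
  split=> [x y xy|z|a]; first by apply: iI; rewrite -!i'E xy.
    split=> [z0|[x <-]].
      have /ip[x xE] : (p \o k) z = 0 by rewrite -p'E z0 linear0.
      by exists x; apply: kI; rewrite i'E.
    by apply: fI; rewrite p'E /= i'E linear0; apply/ip; exists x.
  have [y yE] := pS (f a).
  have /kg[z zE] : (g \o p) y = 0 by rewrite /= yE; apply/fg; exists a.
  by exists z; apply: fI; rewrite p'E /= zE.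
have [psi psiE] := EA _ _ _ _ ip' phi.
have [psi' psi'E] := EC _ _ _ _ kgp psi.
by exists psi' => a; rewrite -i'E psi'E psiE.
Qed.

(** Pulling an extension B of N back along [r] gives an extension Z of M; a map extended to Z is
    restricted to B along b |-> (b, s (p b)). *)
Lemma ext1_vanishes_retract M N X (s : {linear N -> M}) (r : {linear M -> N}) :
  cancel s r -> ext1_vanishes M X -> ext1_vanishes N X.
Proof.
move=> sK EM A B i p [iI ip pS] phi.
pose d : {linear (B * M)%type -> N} := copairL p (\- r).
have [Z [k [kI kd]]] := kernel_exists d.
have [|i' i'E] := factor_mono kI (f := pairL i \0).
  by move=> a; apply/kd; rewrite /= linear0 subr0; apply/ip; exists a.
have /EM/(_ phi)[psi psiE] : short_exact i' (snd \o k).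
  split=> [x y xy|z|m].
  - by apply: iI; move: (i'E x) (i'E y); rewrite xy => ->; case.
  - split=> [/= z2|[a <-]]; last by rewrite /= i'E.
    have := (kd (k z)).2 (ex_intro _ z erefl); rewrite /= z2 linear0 subr0 => /ip[a aE].
    by exists a; apply: kI; rewrite i'E /= aE -z2; case: (k z).
  - have [b bE] := pS (r m).
    have /kd[z zE] : d (b, m) = 0 by rewrite /= bE subrr.
    by exists z; rewrite /= zE.
have [|h hE] := factor_mono kI (f := pairL idfun (s \o p)).
  by move=> b; apply/kd; rewrite /= sK subrr.
exists (psi \o h) => a /=; rewrite -psiE; congr (psi _); apply: kI.
by rewrite hE i'E /= (ip _).2 ?linear0 //; exists a.
Qed.

Lemma ext1_vanishes_projective P N : projective P -> ext1_vanishes P N.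
Proof.
move=> projP A B i p [iI ip pS] phi.
have [s sK] := projP B P p idfun pS.
have [|r rE] := factor_mono iI (f := idfun \- (s \o p)).
  by move=> b; apply/ip; rewrite /= linearB sK subrr.
exists (phi \o r) => a /=; congr (phi _); apply: iI.
have pia : p (i a) = 0 by apply/ip; exists a.
by rewrite rE /= pia linear0 subr0.
Qed.

(** Dimension shifting: a cocycle on [P n.+1] is a map on the (n+1)-st syzygy, and it extends to
    [P n] because the n-th syzygy is still in [G]. *)
Lemma Ext_vanishes_of_ext1 (G : lmod_class R) N :
    (forall X, G X -> ext1_vanishes X N) ->
    (forall K P X (i : {linear K -> P}) (p : {linear P -> X}),
       projective P -> short_exact i p -> G X -> G K) ->
  forall M n, (0 < n)%N -> G M -> Ext_vanishes n M N.
Proof.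
move=> GE Gsyz M [//|n] _ GM P d eps [projP dd deps epsS].
(* [Z] is the k-th syzygy, presented as the cokernel of [d k]; for k = 0 it is [M] itself. *)
have syz k : exists (Z : lmodType R) (e : {linear P k -> Z}),
    [/\ G Z, exact_at (d k) e & forall z, exists x, e x = z].
  elim: k => [|k [Z [e [GZ de eS]]]]; first by exists M, eps.
  have [Z' [i [iI ie]]] := kernel_exists e.
  have [|e' e'E] := factor_mono iI (f := d k).
    by move=> x; apply/ie/de; exists x.
  exists Z', e'; split.
  - exact: (Gsyz _ _ _ _ _ (projP k) (And3 iI ie eS) GZ).
  - move=> x; apply: (iff_trans _ (dd k x)).
    by rewrite -e'E; split=> [->|e0]; [rewrite linear0|apply: iI; rewrite linear0].
  - move=> z; have /de[x xE] : e (i z) = 0 by apply/ie; exists z.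
    by exists x; apply: iI; rewrite e'E.
have [Z [e [GZ de eS]]] := syz n.
have [Z' [i [iI ie]]] := kernel_exists e.
have [|e' e'E] := factor_mono iI (f := d n).
  by move=> x; apply/ie/de; exists x.
have e'S z : exists x, e' x = z.
  have /de[x xE] : e (i z) = 0 by apply/ie; exists z.
  by exists x; apply: iI; rewrite e'E.
move=> phi; split=> [phi0|[psi psiE] x]; last first.
  by rewrite -psiE (dd n _).2 ?linear0 //; exists x.
have [|phi' phi'E] := factor_epi (f := phi) e'S.
  move=> x e0; have /dd[y <-] : d n x = 0 by rewrite -e'E e0 linear0.
  exact: phi0.
have [psi psiE] := GE Z GZ _ _ _ _ (And3 iI ie eS) phi'.
by exists psi => y; rewrite -e'E psiE phi'E.
Qed.

End Ext1.

(** * Free modules and dual bases of projective modules *)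

Section FreeModule.
Variables (S : pzRingType) (I : choiceType).

Definition finsupp_pred : {pred I -> S^o} :=
  fun c => `[< exists s : seq I, forall x, x \notin s -> c x = 0 >].

Fact finsupp_submod_closed : submod_closed finsupp_pred.
Proof.
split=> [|a c c' /asboolP[s sc] /asboolP[s' sc']]; apply/asboolP.
  by exists [::].
exists (s ++ s') => x; rewrite mem_cat negb_or => /andP[xs xs'].
by rewrite fctE /= scalrfctE sc // sc' // scaler0 addr0.
Qed.
HB.instance Definition _ :=
  GRing.isSubmodClosed.Build S (I -> S^o) finsupp_pred finsupp_submod_closed.

Record free_mod :=
  FreeMod { free_val :> I -> S^o ; free_valP : free_val \in finsupp_pred }.
HB.instance Definition _ := [isSub for free_val].
HB.instance Definition _ := [Choice of free_mod by <:].
HB.instance Definition _ := [SubChoice_isSubLmodule of free_mod by <:].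

Fact free_basis_subproof x : (fun y => (y == x)%:R : S^o) \in finsupp_pred.
Proof. by apply/asboolP; exists [:: x] => y; rewrite inE => /negPf->. Qed.
Definition free_basis x : free_mod := FreeMod (free_basis_subproof x).

Fact free_coord_subproof x : linear (fun c : free_mod => c x).
Proof. by []. Qed.
Definition free_coord x : {linear free_mod -> S^o} := linear_of (free_coord_subproof x).

End FreeModule.

(** The expansion is required over every longer duplicate-free list, so that several elements can be
    expanded over one common list. *)
Definition dual_basis (S : pzRingType) (M : lmodType S) (I : eqType) (b : I -> M)
    (phi : I -> {linear M -> S^o}) :=
  forall m, exists s : seq I, forall s', uniq s' -> {subset s <= s'} ->
    m = \sum_(x <- s') (phi x m : S) *: b x.

Lemma free_dual_basis (S : pzRingType) (I : choiceType) :
  dual_basis (@free_basis S I) (@free_coord S I).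
Proof.
move=> c; have /asboolP[s sc] := free_valP c.
exists s => s' s'U ss'; apply/val_inj/funext => x.
rewrite raddf_sum /= fct_sumE.
under eq_bigr do rewrite scalrfctE /=.
have [xs'|xs'] := boolP (x \in s'); last first.
  rewrite big_seq big1 ?sc //; first by apply: contra xs' => /ss'.
  move=> y ys'; rewrite (_ : x == y = false) ?scaler0 //.
  by apply: contraNF xs' => /eqP->.
rewrite (bigD1_seq x) //= eqxx big1 => [|y /negPf yx]; last first.
  by rewrite eq_sym yx scaler0.
by rewrite addr0 /GRing.scale /= mulr1.
Qed.

Definition scale_at (S : pzRingType) (M : lmodType S) (m : M) : {linear S^o -> M}.
Proof.
apply: (@linear_of S S^o M (fun a => (a : S) *: m)) => a b c.
by rewrite scalerDl scalerA.
Defined.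

(** [coproduct_closed] speaks of the universal property, so it is proved here in that form; its
    existence half gives lifts of maps on the basis, its uniqueness half gives projectivity. *)
Lemma free_is_coproduct (S : pzRingType) (I : choiceType) :
  is_coproduct (fun x => scale_at (@free_basis S I x)).
Proof.
move=> N f; have /choice[s sE] := @free_dual_basis S I.
pose ev t (c : free_mod S I) := \sum_(x <- t) f x (free_coord S x c).
pose g c := ev (undup (s c)) c.
have coord0 c x : x \notin s c -> free_coord S x c = 0.
  move=> xs; rewrite {1}(sE c (undup (s c)) (undup_uniq _)) => [|y]; last first.
    by rewrite mem_undup.
  rewrite linear_sum big_seq big1 // => y; rewrite mem_undup => ys.
  rewrite linearZ /= (_ : x == y = false) ?scaler0 //.
  by apply: contraNF xs => /eqP->.
(* The lists [s c] are chosen separately for each [c], so linearity of [g] can only be seen after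
   replacing them by a common longer list. *)
have gE c t : uniq t -> {subset s c <= t} -> g c = ev t c.
  move=> tU st; rewrite /g /ev [RHS](bigID (mem (s c))) /= [X in _ + X]big1 ?addr0.
    rewrite -[RHS]big_filter; apply: perm_big.
    apply: uniq_perm; rewrite ?undup_uniq ?filter_uniq //.
    by move=> x; rewrite mem_undup mem_filter andb_idr // => /st.
  by move=> x /coord0 /= ->; rewrite linear0.
have gL : linear g.
  move=> a c c'; pose t := undup (s (a *: c + c') ++ s c ++ s c').
  have tE u : {subset s u <= s (a *: c + c') ++ s c ++ s c'} -> g u = ev t u.
    by move=> ut; apply: gE; rewrite ?undup_uniq // => x /ut; rewrite mem_undup.
  rewrite !tE; try by move=> x xs; rewrite !mem_cat xs ?orbT.
  rewrite /ev scaler_sumr -big_split; apply: eq_bigr => x _.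
  by rewrite !linearP.
exists (linear_of gL); split=> [x a|g' g'E c].
  pose c := scale_at (free_basis S x) a.
  have cE y : free_coord S y c = if y == x then a else 0.
    have -> : free_coord S y c = a * (y == x)%:R by [].
    by case: eqP => _; rewrite ?mulr1 ?mulr0.
  change (g c = f x a); rewrite (@gE c (undup (x :: s c)) (undup_uniq _)); last first.
    by move=> y ys; rewrite mem_undup inE ys orbT.
  rewrite /ev (bigD1_seq x) ?undup_uniq ?mem_undup ?mem_head // big1 => [|y /negPf yx].
    by rewrite cE eqxx Monoid.mulm1.
  by rewrite cE yx linear0.
rewrite {1}(sE c (undup (s c)) (undup_uniq _)) => [|y]; last by rewrite mem_undup.
by rewrite linear_sum; apply: eq_bigr => x _; rewrite -g'E.
Qed.

Lemma free_lift (S : pzRingType) (I : choiceType) (M : lmodType S) (m : I -> M) :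
  exists g : {linear free_mod S I -> M}, forall x, g (free_basis S x) = m x.
Proof.
have [g [gE _]] := free_is_coproduct (fun x => scale_at (m x)).
by exists g => x; have := gE x 1; rewrite /= !scale1r.
Qed.

Lemma free_projective (S : pzRingType) (I : choiceType) : projective (free_mod S I).
Proof.
move=> M N g f gS; have [m mE] := choice (fun x => gS (f (free_basis S x))).
have [h hE] := free_lift m; exists h.
have [u [_ uU]] := free_is_coproduct (fun x : I => f \o scale_at (free_basis S x)).
have gh : g \o h =1 u.
  by apply: (uU (g \o h)) => x a; rewrite /= !linearZ hE mE.
by move=> c; rewrite [LHS]gh; apply/esym/uU.
Qed.

Lemma free_epi (S : pzRingType) (M : lmodType S) :
  exists p : {linear free_mod S M -> M}, forall m, exists c, p c = m.
Proof. by have [p pE] := free_lift (@id M); exists p => m; exists (free_basis S m). Qed.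

Lemma projective_retract_free (S : pzRingType) (P : lmodType S) :
  projective P ->
  exists (s : {linear P -> free_mod S P}) (p : {linear free_mod S P -> P}), cancel s p.
Proof.
move=> projP; have [p pS] := free_epi P.
by have [s sK] := projP _ _ p idfun pS; exists s, p.
Qed.

Lemma projective_dual_basis (S : pzRingType) (P : lmodType S) :
  projective P -> exists (b : P -> P) (phi : P -> {linear P -> S^o}), dual_basis b phi.
Proof.
move=> /projective_retract_free[s [p sK]].
exists (p \o @free_basis S P), (fun x => free_coord S x \o s) => m.
have [t tE] := free_dual_basis (s m); exists t => t' t'U tt'.
rewrite -[LHS]sK {1}(tE t' t'U tt') linear_sum.
by apply: eq_bigr => x _; rewrite linearZ.
Qed.

(** * Character modules and the projectives in L *)

Section CharacterModule.
Variable R : pzRingType.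

Definition lchar_map (M N : lmodType R) (f : {linear M -> N}) :
  {linear lchar N -> lchar M}.
Proof.
apply: (@linear_of R^c (lchar N) (lchar M)
  (fun c : lchar N => (char_fun c \o f : char M) : lchar M)).
by move=> a c c'; apply: charP => x; rewrite /= /char_fun /= -linearZ.
Defined.

End CharacterModule.

(** Converts a retraction into the direct sum decomposition that [summand_closed] expects; the
    complement is the kernel of [r]. *)
Lemma retract_isomorphic (S : pzRingType) (M W : lmodType S)
    (s : {linear M -> W}) (r : {linear W -> M}) :
  cancel s r -> exists K : lmodType S, isomorphic W (M * K)%type.
Proof.
move=> sK; have [K [k [kI kr]]] := kernel_exists r.
have [|q qE] := factor_mono kI (f := idfun \- (s \o r)).
  by move=> w; apply/kr; rewrite /= linearB sK subrr.
have rk z : r (k z) = 0 by apply/kr; exists z.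
exists K, (pairL r q), (copairL s k) => [w|[m z]] /=.
  by rewrite qE /= addrC subrK.
rewrite linearD sK rk addr0; congr (_, _); apply: kI.
by rewrite qE /= linearD sK rk addr0 addrAC subrr add0r.
Qed.

(** L contains the free modules, being closed under coproducts. Characters turn the retraction of a
    free module F onto P into one of F^+ onto P^+, so P^+ is in A as a summand of F^+, and P is in L
    by duality. *)
Lemma perfect_pair_projective (R : pzRingType) (L : lmod_class R) (A : lmod_class R^c) :
  perfect_duality_pair L A -> forall P, projective P -> L P.
Proof.
move=> [[_ _ LA AS _] LR LC _] P /projective_retract_free[s [p sK]].
apply/LA.
have sK' : cancel (lchar_map p) (lchar_map s).
  by move=> c; apply: charP => x; rewrite /char_fun /= sK.
have [K WK] := retract_isomorphic sK'.
apply: AS WK _; apply/LA.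
exact: LC (@free_is_coproduct R P) (fun=> LR).
Qed.

(** * Tensor products and flatness *)

Section Tensor.
Variable R : pzRingType.
Implicit Types (A B C F : lmodType R^c) (K M N P : lmodType R).

(** The proof [bP] is kept as an argument so that additivity can be attached to the lift as a
    structure. *)
Definition additive_lift A M (V : zmodType) (b : A -> M -> V) (bP : balanced b) :
  tensor A M -> V := tensor_lift b.
HB.instance Definition _ A M V b bP :=
  GRing.isZmodMorphism.Build (tensor A M) V (@additive_lift A M V b bP)
    (tensor_liftB bP).

Lemma additive_liftE A M (V : zmodType) (b : A -> M -> V) (bP : balanced b) a m :
  additive_lift bP (tens a m) = b a m.
Proof. exact: (tensor_lift_tens bP). Qed.

Lemma tens_mapr_balanced A M N (g : {linear M -> N}) :
  balanced (fun (a : A) m => tens a (g m)).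
Proof.
have [tDl tDr tZ] := tens_balanced A N.
split=> [a a' m|a m m'|r a m]; first exact: tDl.
  by rewrite linearD tDr.
by rewrite tZ linearZ.
Qed.

Definition tensor_mapr (A : lmodType R^c) M N (g : {linear M -> N}) :
    tensor A M -> tensor A N :=
  tensor_lift (fun a m => tens a (g m)).
Arguments tensor_mapr A {M N} g.
HB.instance Definition _ A M N g :=
  GRing.isZmodMorphism.Build (tensor A M) (tensor A N) (@tensor_mapr A M N g)
    (tensor_liftB (@tens_mapr_balanced A M N g)).

Lemma tensor_mapr_tens A M N (g : {linear M -> N}) (a : A) m :
  tensor_mapr A g (tens a m) = tens a (g m).
Proof. exact: (tensor_lift_tens (@tens_mapr_balanced A M N g)). Qed.

Lemma tens0r A M (a : A) : tens a (0 : M) = 0.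
Proof.
have [_ tDr _] := tens_balanced A M.
by apply: (addrI (tens a 0)); rewrite -tDr !addr0.
Qed.

Lemma tens0l A M (m : M) : tens (0 : A) m = 0.
Proof.
have [tDl _ _] := tens_balanced A M.
by apply: (addrI (tens 0 m)); rewrite -tDl !addr0.
Qed.

Lemma tens_suml A M (I : Type) (s : seq I) (f : I -> A) (m : M) :
  tens (\sum_(x <- s) f x) m = \sum_(x <- s) tens (f x) m.
Proof.
have [tDl _ _] := tens_balanced A M.
exact: (big_morph (fun a => tens a m) (fun a a' => tDl a a' m) (tens0l A m)).
Qed.

Lemma tens_sumr A M (I : Type) (s : seq I) (a : A) (f : I -> M) :
  tens a (\sum_(x <- s) f x) = \sum_(x <- s) tens a (f x).
Proof.
have [_ tDr _] := tens_balanced A M.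
exact: (big_morph _ (tDr a) (tens0r M a)).
Qed.

(** [S] is a subgroup, and the quotient map by it agrees with zero on pure tensors, hence
    everywhere. *)
Lemma tensor_ind A M (S : tensor A M -> Prop) :
    (forall a m, S (tens a m)) -> (forall x y, S x -> S y -> S (x - y)) ->
  forall t, S t.
Proof.
move=> St SB t.
have [|Q [p [_ pE]]] := @zquotient_exists (tensor A M) (fun x => `[< S x >]).
  split=> [|x y /asboolP Sx /asboolP Sy]; apply/asboolP; last exact: SB.
  by rewrite -(tens0r M 0); apply: St.
have p0 : p =1 (\0 : {additive tensor A M -> Q}).
  by apply: tensor_ext => a m; apply/pE/asboolP.
by have /pE/asboolP := p0 t.
Qed.

Lemma tensor_map_mapr A B M N (f : {linear A -> B}) (g : {linear M -> N}) t :
  tensor_map N f (tensor_mapr A g t) = tensor_mapr B g (tensor_map M f t).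
Proof.
apply: (@tensor_ext _ _ _ _ (tensor_map N f \o tensor_mapr A g)
  (tensor_mapr B g \o tensor_map M f)) => a m /=.
by rewrite tensor_mapr_tens !tensor_map_tens tensor_mapr_tens.
Qed.

(** For exactness in the middle, c (x) m |-> p (s c (x) m), with [s] a set-theoretic section of [g],
    is well defined into the cokernel of A (x) M -> B (x) M and factors [p] through C (x) M. *)
Lemma tensor_map_right_exact A B C (f : {linear A -> B}) (g : {linear B -> C}) M :
    short_exact f g ->
  exact_at (tensor_map M f) (tensor_map M g) /\
  forall z, exists y, tensor_map M g y = z.
Proof.
move=> fg; have [fI fgE gS] := fg.
have gf0 t : tensor_map M g (tensor_map M f t) = 0.
  apply: (@tensor_ext _ _ _ _ (tensor_map M g \o tensor_map M f) \0) => a m /=.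
  by rewrite !tensor_map_tens (short_exact0 _ fg) tens0l.
split=> [t|z]; last first.
  have [Q [p [pE pS]]] := zcokernel_exists (tensor_map M g).
  apply/pE; apply: (@tensor_ext _ _ _ _ p \0) => c m.
  by have [b <-] := gS c; rewrite -tensor_map_tens; apply/pE; exists (tens b m).
split=> [gt0|[u <-] //].
have [Q [p [pE pS]]] := zcokernel_exists (tensor_map M f).
have [s sK] := choice gS.
have sE b m : p (tens (s (g b)) m) = p (tens b m).
  have [tDl _ _] := tens_balanced B M.
  have /fgE[a aE] : g (s (g b) - b) = 0 by rewrite linearB sK subrr.
  rewrite -[s (g b)](subrK b) tDl raddfD -aE -tensor_map_tens.
  by rewrite (_ : p (tensor_map M f _) = 0) ?add0r //; apply/pE; exists (tens a m).
have bP : balanced (fun c (m : M) => p (tens (s c) m)).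
  have [tDl tDr tZ] := tens_balanced B M.
  split=> [c c' m|c m m'|r c m]; last 2 first.
  - by rewrite tDr raddfD.
  - by rewrite -tZ -[in RHS]sE linearZ sK.
  - by rewrite -raddfD -tDl -[in RHS]sE linearD !sK.
apply/pE; have <- : additive_lift bP (tensor_map M g t) = p t.
  apply: (@tensor_ext _ _ _ _ (additive_lift bP \o tensor_map M g) p) => b m /=.
  by rewrite tensor_map_tens additive_liftE.
by rewrite gt0 raddf0.
Qed.

Lemma tensor_mapr_exact K P M (i : {linear K -> P}) (p : {linear P -> M}) A :
  short_exact i p -> exact_at (tensor_mapr A i) (tensor_mapr A p).
Proof.
move=> ip; have [_ ipE pS] := ip => t; split=> [pt0|[u <-]]; last first.
  apply: (@tensor_ext _ _ _ _ (tensor_mapr A p \o tensor_mapr A i) \0) => a m /=.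
  by rewrite !tensor_mapr_tens (short_exact0 _ ip) tens0r.
have [Q [q [qE _]]] := zcokernel_exists (tensor_mapr A i).
have [s sK] := choice pS.
have [tDl tDr tZ] := tens_balanced A P.
have sE a x : q (tens a (s (p x))) = q (tens a x).
  have /ipE[k kE] : p (s (p x) - x) = 0 by rewrite linearB sK subrr.
  rewrite -[s (p x)](subrK x) tDr raddfD -kE -tensor_mapr_tens.
  by rewrite (_ : q (tensor_mapr A i _) = 0) ?add0r //; apply/qE; exists (tens a k).
have bP : balanced (fun a m => q (tens a (s m))).
  split=> [a a' m|a m m'|r a m].
  - by rewrite tDl raddfD.
  - by rewrite -raddfD -tDr -[in RHS]sE linearD !sK.
  - by rewrite tZ -sE linearZ sK.
apply/qE; have <- : additive_lift bP (tensor_mapr A p t) = q t.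
  apply: (@tensor_ext _ _ _ _ (additive_lift bP \o tensor_mapr A p) q) => a x /=.
  by rewrite tensor_mapr_tens additive_liftE.
by rewrite pt0 raddf0.
Qed.

(** A tensor t is the finite sum of the c_x(t) (x) b x, where c_x sends a (x) m to a phi_x(m). The
    coordinates c_x are natural in the right module, so an injective [f] detects when they
    vanish. *)
Lemma tensor_map_inj_dual_basis A B M (I : eqType) (b : I -> M)
    (phi : I -> {linear M -> R^o}) (f : {linear A -> B}) :
  dual_basis b phi -> injective f -> injective (tensor_map M f).
Proof.
move=> bphi fI.
have cP x D : balanced (fun (d : D : lmodType R^c) m => (phi x m : R^c) *: d).
  split=> [d d' m|d m m'|r d m]; first exact: scalerDr.
    by rewrite linearD scalerDl.
  by rewrite linearZ scalerA.
have expand t : exists s : seq I, forall s', uniq s' -> {subset s <= s'} ->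
    t = \sum_(x <- s') tens (additive_lift (cP x A) t) (b x).
  elim/tensor_ind: t => [a m|t t' [s sE] [s' s'E]].
    have [s sE] := bphi m; exists s => s' s'U ss'.
    rewrite {1}(sE s' s'U ss') tens_sumr; apply: eq_bigr => x _.
    by have [_ _ tZ] := tens_balanced A M; rewrite additive_liftE tZ.
  exists (s ++ s') => u uU su.
  rewrite {1}(sE u) // => [|x xs]; last by rewrite su // mem_cat xs.
  rewrite {1}(s'E u) // => [|x xs]; last by rewrite su // mem_cat xs orbT.
  rewrite -sumrB; apply: eq_bigr => x _.
  have [tDl _ _] := tens_balanced A M.
  by rewrite raddfB; apply/eqP; rewrite subr_eq -tDl subrK.
move=> t t' ftt'; apply/eqP; rewrite -subr_eq0; apply/eqP.
have [s sE] := expand (t - t').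
rewrite (sE (undup s)) ?undup_uniq // => [|x]; last by rewrite mem_undup.
apply: big1 => x _; rewrite (_ : additive_lift _ _ = 0) ?tens0l //.
apply: fI; rewrite linear0.
suff -> : f (additive_lift (cP x A) (t - t')) =
    additive_lift (cP x B) (tensor_map M f (t - t')).
  by rewrite [X in additive_lift _ X](raddfB (tensor_map M f)) /= ftt' subrr raddf0.
apply: (@tensor_ext _ _ _ _ (f \o additive_lift (cP x A))
  (additive_lift (cP x B) \o tensor_map M f)) => a m /=.
by rewrite tensor_map_tens !additive_liftE linearZ.
Qed.

(** The mirror image, with the dual basis on the right module and coordinates in the left one. *)
Lemma tensor_mapr_inj_dual_basis F M N (I : eqType) (b : I -> F)
    (phi : I -> {linear F -> R^c^o}) (g : {linear M -> N}) :
  dual_basis b phi -> injective g -> injective (tensor_mapr F g).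
Proof.
move=> bphi gI.
have cP x (D : lmodType R) : balanced (fun c (d : D) => (phi x c : R) *: d).
  split=> [c c' d|c d d'|r c d]; last 1 first.
  - by rewrite linearZ scalerA.
  - by rewrite linearD scalerDl.
  - exact: scalerDr.
have expand t : exists s : seq I, forall s', uniq s' -> {subset s <= s'} ->
    t = \sum_(x <- s') tens (b x) (additive_lift (cP x M) t).
  elim/tensor_ind: t => [a m|t t' [s sE] [s' s'E]].
    have [s sE] := bphi a; exists s => s' s'U ss'.
    rewrite {1}(sE s' s'U ss') tens_suml; apply: eq_bigr => x _.
    by have [_ _ tZ] := tens_balanced F M; rewrite additive_liftE -tZ.
  exists (s ++ s') => u uU su.
  rewrite {1}(sE u) // => [|x xs]; last by rewrite su // mem_cat xs.
  rewrite {1}(s'E u) // => [|x xs]; last by rewrite su // mem_cat xs orbT.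
  rewrite -sumrB; apply: eq_bigr => x _.
  have [_ tDr _] := tens_balanced F M.
  by rewrite raddfB; apply/eqP; rewrite subr_eq -tDr subrK.
move=> t t' gtt'; apply/eqP; rewrite -subr_eq0; apply/eqP.
have [s sE] := expand (t - t').
rewrite (sE (undup s)) ?undup_uniq // => [|x]; last by rewrite mem_undup.
apply: big1 => x _; rewrite (_ : additive_lift _ _ = 0) ?tens0r //.
apply: gI; rewrite linear0.
suff -> : g (additive_lift (cP x M) (t - t')) =
    additive_lift (cP x N) (tensor_mapr F g (t - t')).
  by rewrite [X in additive_lift _ X](raddfB (tensor_mapr F g)) /= gtt' subrr raddf0.
apply: (@tensor_ext _ _ _ _ (g \o additive_lift (cP x M))
  (additive_lift (cP x N) \o tensor_mapr F g)) => a m /=.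
by rewrite tensor_mapr_tens !additive_liftE linearZ.
Qed.

Lemma projective_flat P : projective P -> flat P.
Proof.
move=> /projective_dual_basis[b [phi bphi]] A B C f g fg.
have [gfE gS] := tensor_map_right_exact P fg.
by split=> //; apply: tensor_map_inj_dual_basis bphi _; case: fg.
Qed.

(* [K -> P] stays injective under tensoring with any [A] because [M] is flat:
   chase through a free presentation of [A]. *)
Lemma flat_tensor_mapr_inj K P M (i : {linear K -> P}) (p : {linear P -> M}) A :
  short_exact i p -> flat M -> injective (tensor_mapr A i).
Proof.
move=> ip flatM.
have [q qS] := free_epi A.
have [D [n nq]] := short_exact_kernel qS.
suff inj0 t : tensor_mapr A i t = 0 -> t = 0.
  move=> t t' tt'; apply/eqP; rewrite -subr_eq0; apply/eqP/inj0.
  by rewrite raddfB /= tt' subrr.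
move=> it0.
have [nqK qKS] := tensor_map_right_exact K nq.
have [nqP _] := tensor_map_right_exact P nq.
have [y yE] := qKS t.
have /nqP[z zE] : tensor_map P q (tensor_mapr _ i y) = 0.
  by rewrite tensor_map_mapr yE.
have ipA := @tensor_mapr_exact _ _ _ _ _ (free_mod R^c A) ip.
have ipD := @tensor_mapr_exact _ _ _ _ _ D ip.
have pz0 : tensor_mapr D p z = 0.
  have [nI _ _] := flatM _ _ _ _ _ nq.
  apply: nI; rewrite tensor_map_mapr zE raddf0.
  by apply/ipA; exists y.
have /ipD[w wE] := pz0.
have iI : injective i by case: ip.
have nw : tensor_map K n w = y.
  apply: (tensor_mapr_inj_dual_basis (@free_dual_basis _ _) iI).
  by rewrite -tensor_map_mapr wE.
by rewrite -yE -nw; apply/nqK; exists w.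
Qed.

(** A (x) K -> A (x) P -> B (x) P is injective, by flatness of M and then of P, and it factors
    through A (x) K -> B (x) K. *)
Lemma flat_epikernel : epikernel_closed (@flat R).
Proof.
move=> K P M i p ip flatP flatM A B C f g fg.
have [fgE gS] := tensor_map_right_exact K fg.
split=> // t t' ftt'; apply: (flat_tensor_mapr_inj ip flatM).
have [fI _ _] := flatP _ _ _ _ _ fg.
by apply: fI; rewrite !tensor_map_mapr ftt'.
Qed.

End Tensor.

(** * Gorenstein projective modules and their closure properties *)

Lemma int_chain (T : Type) (rel : T -> T -> Prop) :
    (forall x, exists y, rel y x) -> (forall x, exists y, rel x y) ->
  forall x, exists st : int -> T, st 0 = x /\ forall i, rel (st (1 + i)) (st i).
Proof.
move=> /choice[l lE] /choice[r rE] x.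
exists (fun i => if i is Posz n then iter n l x else iter (absz i) r x).
split=> // -[n|[|n]].
- exact: lE.
- exact: rE.
- have -> : 1 + Negz n.+1 = Negz n by case: n.
  exact: rE.
Qed.

(** Cuts an exact sequence into short exact ones: the kernel of [g] is the image of [f], hence a
    quotient of [A]. *)
Lemma kernel_short_exact (R : pzRingType) (K X A B C : lmodType R)
    (f : {linear A -> B}) (g : {linear B -> C})
    (k : {linear K -> A}) (x : {linear X -> B}) :
    exact_at f g -> is_kernel k f -> is_kernel x g ->
  exists2 e : {linear A -> X}, short_exact k e & forall a, x (e a) = f a.
Proof.
move=> fg [kI kf] [xI xg].
have [|e eE] := factor_mono xI (f := f).
  by move=> a; apply/xg/fg; exists a.
exists e => //; split=> // [a|y].
  apply: (iff_trans _ (kf a)); rewrite -eE.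
  by split=> [->|e0]; [rewrite linear0|apply: xI; rewrite linear0].
have /fg[a aE] : g (x y) = 0 by apply/xg; exists y.
by exists a; apply: xI; rewrite eE.
Qed.

Section GorensteinProjective.
Variables (R : pzRingType) (L : lmod_class R).
Implicit Types (G : lmod_class R) (A B C D K M N P Q V W X Y Z : lmodType R).

Let GP := gorenstein_projective L.

Definition has_syzygy G X :=
  exists Q K (i : {linear K -> Q}) (p : {linear Q -> X}),
    [/\ projective Q, short_exact i p & G K].

Definition has_cosyzygy G X :=
  exists Q Y (i : {linear X -> Q}) (p : {linear Q -> Y}),
    [/\ projective Q, short_exact i p & G Y].

Definition bisyzygetic G := forall X, G X ->
  [/\ forall N, L N -> ext1_vanishes X N, has_syzygy G X & has_cosyzygy G X].

(** Syzygies and cosyzygies chosen without end give sequences 0 -> Z (1 + i) -> Q i -> Z i -> 0 for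
    all integers i, with Z 0 = M; splicing them gives the complex. *)
Lemma gorenstein_projective_sub G M : bisyzygetic G -> G M -> GP M.
Proof.
move=> GG GM; pose T := {X | G X}.
pose rel (K X : T) := exists Q (i : {linear sval K -> Q}) (p : {linear Q -> sval X}),
  projective Q /\ short_exact i p.
have [||st [st0 strel]] := @int_chain T rel _ _ (exist G M GM).
- move=> [X GX]; have [_ [Q [K [i [p [projQ ip GK]]]]] _] := GG X GX.
  by exists (exist G K GK), Q, i, p.
- move=> [X GX]; have [_ _ [Q [K [i [p [projQ ip GK]]]]]] := GG X GX.
  by exists (exist G K GK), Q, i, p.
pose Z i : lmodType R := sval (st i).
have /choice[Q] : forall i, exists Q
  (j : {linear Z (1 + i) -> Q}) (p : {linear Q -> Z i}),
  projective Q /\ short_exact j p := strel.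
move=> /dependent_choice_fun[j] /dependent_choice_fun[p] jpP.
have projQ i : projective (Q i) := (jpP i).1.
have jp i : short_exact (j i) (p i) := (jpP i).2.
pose d i : {linear Q (1 + i) -> Q i} := j i \o p (1 + i).
have jI i : injective (j i) by case: (jp i).
have pS i z : exists x, p i x = z by case: (jp i) => _ _; apply.
have pE i x : p i x = 0 <-> exists y, j i y = x by case: (jp i) => _ + _; apply.
have d0 i x : d i x = 0 <-> p (1 + i) x = 0.
  by split=> [dx0|/= ->]; [apply: (jI i); rewrite linear0|rewrite linear0].
exists Q, d; split=> [//|i y|i N LN phi|].
- apply: (iff_trans (d0 i y)); apply: (iff_trans (pE _ y)).
  split=> [[z <-]|[x <-]]; last by exists (p (1 + (1 + i)) x).
  by have [x <-] := pS _ z; exists x.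
- split=> [phid|[psi psiE] x]; last first.
    rewrite -psiE; apply: etrans (linear0 psi); congr (psi _).
    by apply/d0/pE; exists (p (1 + (1 + i)) x).
  (* A cocycle descends to [Z (1 + i)] and extends along [j i] since Ext^1(Z i, N) = 0. *)
  have [|phi' phi'E] := factor_epi (f := phi) (pS (1 + i)).
    by move=> x /pE[y <-]; have [z <-] := pS _ y; apply: phid.
  have [EN _ _] := GG _ (svalP (st i)).
  have [psi psiE] := EN N LN _ _ _ _ (jp i) phi'.
  by exists psi => y /=; rewrite psiE phi'E.
(* The kernel of [d i] is [Z (1 + (1 + i))], which for i = -2 is [Z 0], that is [M]. *)
- rewrite -/(is_kernel _ _) -[M]/(sval (exist G M GM)) -st0.
  exists (j (1 + (-2))); split=> [|x]; first exact: jI.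
  by apply: (iff_trans (d0 _ x)); apply: pE.
Qed.

Lemma gorenstein_projective_bisyzygetic : bisyzygetic GP.
Proof.
move=> M [P [d [projP dd dL [iota iotaK]]]].
(* The kernels of all differentials of this one complex form a bisyzygetic class, so the neighbours
   of [M] in the complex are Gorenstein projective too. *)
pose G X := exists i (k : {linear X -> P (1 + i)}), is_kernel k (d i).
suff GG : bisyzygetic G.
  have GM : G M by exists (-2), iota.
  have [EM [Q [K [i [p [projQ ip GK]]]]] [Q' [Y [i' [p' [projQ' ip' GY]]]]]] := GG M GM.
  split=> //.
    by exists Q, K, i, p; split=> //; apply: gorenstein_projective_sub GK.
  by exists Q', Y, i', p'; split=> //; apply: gorenstein_projective_sub GY.
move=> X [i [x xK]].
have [K [k kK]] := kernel_exists (d (1 + i)).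
have [e ke eE] := kernel_short_exact (dd i) kK xK; split.
- move=> N LN; apply: (ext1_vanishes_presentation (projP _) ke) => phi.
  have [K' [k' k'K]] := kernel_exists (d (1 + (1 + i))).
  have [e' ke' e'E] := kernel_short_exact (dd _) k'K kK.
  have [|psi psiE] := (dL (1 + (1 + i)) N LN (phi \o e')).1.
    move=> y /=; have -> : e' (d (1 + (1 + (1 + i))) y) = 0; last exact: (linear0 phi).
    by case: kK => kI _; apply: kI; rewrite e'E linear0; apply/dd; exists y.
  by exists psi => a; have [_ _ /(_ a)[y <-]] := ke'; rewrite e'E psiE.
- by exists (P (1 + (1 + i))), K, k, e; split=> //; exists (1 + i), k.
(* The cosyzygy is the kernel of the differential of index i - 1. Writing i as 1 + (i - 1) and
   generalizing makes the types match without a transport. *)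
- clear K k kK e ke eE; move: x xK.
  have -> : i = 1 + (i - 1) by rewrite addrC subrK.
  move: (i - 1) => {}i x xK.
  have [Y [y yK]] := kernel_exists (d i).
  have [e xe _] := kernel_short_exact (dd i) xK yK.
  by exists (P (1 + (1 + i))), Y, x, e; split=> //; exists i, y.
Qed.

Lemma gorenstein_projective_ext1 X N : GP X -> L N -> ext1_vanishes X N.
Proof. by move=> /gorenstein_projective_bisyzygetic[EX _ _]; apply: EX. Qed.

Lemma projective_gorenstein P : projective P -> GP P.
Proof.
apply: gorenstein_projective_sub => {}P projP.
(* Row vectors of length 0 are the zero module, which serves both as syzygy and as cosyzygy of
   [P]. *)
have projO : projective ('rV[R]_0 : lmodType R).
  by move=> M N g f gS; exists \0 => x; rewrite [x]thinmx0 !linear0.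
split=> [N _| |]; first exact: ext1_vanishes_projective.
- exists P, 'rV[R]_0, \0, idfun; split=> //; split=> [x y _|x|x]; last by exists x.
    by rewrite [x]thinmx0 [y]thinmx0.
  by split=> /= [->|[y <-]] //; exists 0.
- exists P, 'rV[R]_0, idfun, \0; split=> //; split=> [x y //|x|x].
    by split=> // _; exists x.
  by exists 0; rewrite [x]thinmx0.
Qed.

Hypothesis projL : forall P, projective P -> L P.

(* The horseshoe lemma on both sides; on the right [C] must not obstruct
   extending [A -> P] to [B], which is where [L] containing [P] matters. *)
Lemma gorenstein_projective_extension : extension_closed GP.
Proof.
move=> A B C f g fg GA GC.
pose G B := exists A C (f : {linear A -> B}) (g : {linear B -> C}),
  [/\ short_exact f g, GP A & GP C].
apply: (@gorenstein_projective_sub G); last by exists A, C, f, g.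
move=> {A C f g fg GA GC} {}B [A [C [f [g [fgS GA GC]]]]].
have [EA SA CA] := gorenstein_projective_bisyzygetic GA.
have [EC SC CC] := gorenstein_projective_bisyzygetic GC.
have [fI fg gS] := fgS.
split=> [N LN| |].
- by apply: ext1_vanishes_extension fgS _ _; [apply: EA|apply: EC].
- have [P [A' [i [p [projP [iI ip pS] GA']]]]] := SA.
  have [Q [C' [j [q [projQ [jI jq qS] GC']]]]] := SC.
  have [h hE] := projQ B C g q gS.
  pose e : {linear (P * Q)%type -> B} := copairL (f \o p) h.
  have eS b : exists x, e x = b.
    have [y yE] := qS (g b).
    have /fg[a aE] : g (b - h y) = 0 by rewrite linearB hE yE subrr.
    have [x xE] := pS a.
    by exists (x, y); rewrite /= xE aE subrK.
  have [B' [k [kI ke]]] := kernel_exists e.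
  have ge x : g (e x) = q x.2 by rewrite /= linearD hE (short_exact0 _ fgS) add0r.
  have [|i' i'E] := factor_mono kI (f := pairL i \0).
    by move=> a; apply/ke; rewrite /= linear0 addr0 (ip _).2 ?linear0 //; exists a.
  have [|q' q'E] := factor_mono jI (f := snd \o k).
    by move=> b; apply/jq; rewrite /= -ge (ke _).2 ?linear0 //; exists b.
  exists (P * Q)%type, B', k, e; split=> //; first exact: projective_prod.
  exists A', C', i', q'; split=> //; split=> [x y xy|z|y].
  + by apply: iI; move: (i'E x) (i'E y); rewrite xy => ->; case.
  + split=> [z0|[x <-]]; last by apply: jI; rewrite q'E /= i'E linear0.
    have kz2 : (k z).2 = 0 by rewrite -[LHS]q'E z0 linear0.
    have := (ke (k z)).2 (ex_intro _ z erefl).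
    rewrite /= kz2 linear0 addr0 => /(mono_eq0 fI)/ip[x xE].
    by exists x; apply: kI; rewrite i'E /= xE -kz2; case: (k z).
  + have /fg[a aE] : g (h (j y)) = 0 by rewrite hE; apply/jq; exists y.
    have [x xE] := pS a.
    have /ke[z zE] : e (- x, j y) = 0 by rewrite /= !linearN xE aE addNr.
    by exists z; apply: jI; rewrite q'E /= zE.
- have [P [A' [i [p [projP [iI ip pS] GA']]]]] := CA.
  have [Q [C' [j [q [projQ [jI jq qS] GC']]]]] := CC.
  have [u uE] := EC P (projL projP) _ _ _ _ fgS i.
  pose k : {linear B -> (P * Q)%type} := pairL u (j \o g).
  have kI : injective k.
    apply: mono_of_ker => b -[ub0 /(mono_eq0 jI)/fg[a aE]].
    by rewrite -aE (_ : a = 0) ?linear0 //; apply: iI; rewrite -uE aE ub0 linear0.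
  have [B' [c kc]] := short_exact_cokernel kI; have [_ ck cS] := kc.
  have [|i' i'E] := factor_epi (f := c \o pairL idfun \0) pS.
    move=> x /ip[a <-]; apply/ck; exists (f a).
    by rewrite /= uE (short_exact0 _ fgS) linear0.
  have [|q' q'E] := factor_epi (f := q \o snd) cS.
    by move=> x /ck[b <-] /=; apply/jq; exists (g b).
  exists (P * Q)%type, B', k, c; split=> //; first exact: projective_prod.
  exists A', C', i', q'; split=> //; split=> [|z|z].
  + apply: mono_of_ker => y; have [x <-] := pS y.
    rewrite i'E => /ck[b [ubx /(mono_eq0 jI)/fg[a aE]]].
    by apply/ip; exists a; rewrite -uE aE.
  + split=> [|[y <-]]; last first.
      by have [x <-] := pS y; rewrite i'E q'E /= linear0.
    have [[x y] <-] := cS z; rewrite q'E => /jq[d dE].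
    have [b bE] := gS d.
    exists (p (x - u b)); rewrite i'E /=.
    apply/eqP; rewrite -subr_eq0 -linearB; apply/eqP/ck.
    exists (- b); apply: injective_projections => /=; rewrite !linearN /=.
      by rewrite addrAC subrr sub0r.
    by rewrite bE dE sub0r.
  + by have [y <-] := qS z; exists (c (0, y)); rewrite q'E.
Qed.

(* With [N] the kernel of [r], a syzygy [K] of [M] becomes Gorenstein projective
   after adding [M]: [0 -> W'' -> K (+) M -> N (+) M = W -> 0]; dually for the
   cosyzygies. *)
Lemma gorenstein_projective_retract W M (s : {linear M -> W})
    (r : {linear W -> M}) :
  cancel s r -> GP W -> GP M.
Proof.
move=> sK GW.
pose G M := exists W (s : {linear M -> W}) (r : {linear W -> M}), cancel s r /\ GP W.
apply: (@gorenstein_projective_sub G); last by exists W, s, r.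
move=> {W s r sK GW} {}M [W [s [r [sK GW]]]].
have [EW SW CW] := gorenstein_projective_bisyzygetic GW.
split=> [N LN| |].
- exact: ext1_vanishes_retract sK (EW N LN).
- have [Q [W' [i [p [projQ [iI ip pS] GW']]]]] := SW.
  have rpS m : exists x, (r \o p) x = m.
    by have [x xE] := pS (s m); exists x; rewrite /= xE sK.
  have [K [k kse]] := short_exact_kernel rpS; have [kI kp _] := kse.
  exists Q, K, k, (r \o p); split=> //.
  exists (K * M)%type, (pairL idfun \0), fst; split=> //.
  have [|i' i'E] := factor_mono kI (f := i).
    by move=> w; apply/kp; rewrite /= (ip _).2 ?linear0 //; exists w.
  apply: (@gorenstein_projective_extension W' _ W (pairL i' \0)
    (copairL (p \o k) s)) => //; split=> [x y [xy]|[z m]|w].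
  + by apply: iI; rewrite -!i'E xy.
  + split=> [/= pks0|[w [<- <-]]]; last first.
      by rewrite /= i'E linear0 addr0; apply/ip; exists w.
    have m0 : m = 0.
      have /kp/= rpk0 : exists z', k z' = k z by exists z.
      by rewrite -[m]sK -[LHS]add0r -rpk0 -linearD pks0 linear0.
    move: pks0; rewrite m0 linear0 addr0 => /ip[w wE].
    by exists w; congr (_, _); apply: kI; rewrite i'E.
  + have [x xE] := pS (w - s (r w)).
    have /kp[z zE] : (r \o p) x = 0 by rewrite /= xE linearB sK subrr.
    by exists (z, r w); rewrite /= zE xE subrK.
- have [Q [W' [j [p [projQ [jI jp pS] GW']]]]] := CW.
  have jsI : injective (j \o s) by apply: inj_comp jI (can_inj sK).
  have [Y [c cse]] := short_exact_cokernel jsI; have [_ cj cS] := cse.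
  exists Q, Y, (j \o s), c; split=> //.
  exists (Y * M)%type, (pairL idfun \0), fst; split=> //.
  have [|q qE] := factor_epi (f := p) cS.
    by move=> x /cj[m <-]; apply/jp; exists (s m).
  have cjs m : c (j (s m)) = 0 by apply/cj; exists m.
  apply: (@gorenstein_projective_extension W _ W' (pairL (c \o j) r)
    (q \o fst)) => //; split=> [|[y m]|w].
  + apply: mono_of_ker => w [/cj[m mE] rw0].
    have sm : s m = w by apply: jI.
    by rewrite -sm -[m]sK sm rw0 linear0.
  + have [x <-] := cS y; rewrite /= qE.
    split=> [/jp[w wE]|[w [wx _]]]; last first.
      by rewrite -qE -wx qE; apply/jp; exists w.
    (* The correction [s (m - r w)] adjusts the component in [M] and dies in [Y], the cokernel of
       [j \o s]. *)
    exists (w + s (m - r w)); apply: injective_projections => /=.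
      by rewrite (linearD j) (linearD c) cjs addr0 wE.
    by rewrite (linearD r) sK addrC subrK.
  + by have [x <-] := pS w; exists (c x, 0); rewrite /= qE.
Qed.

(** Schanuel's lemma: the pullback V of [p] and of a second presentation [q] with Gorenstein
    projective kernel K' is an extension of P by K'. As Q is projective, V -> Q splits, so its
    kernel K is a retract of V. *)
Lemma gorenstein_projective_syzygy K P X (i : {linear K -> P}) (p : {linear P -> X}) :
  projective P -> short_exact i p -> GP X -> GP K.
Proof.
move=> projP [iI ip pS] GX.
have [_ [Q [K' [j [q [projQ [jI jq qS] GK']]]]] _] :=
  gorenstein_projective_bisyzygetic GX.
have [V [v [vI vK]]] := kernel_exists (copairL p (\- q)).
have vE z : p (v z).1 = q (v z).2.
  by apply/eqP; rewrite -subr_eq0; apply/eqP/vK; exists z.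
have [h hE] := projQ P X p q pS.
have [|s sE] := factor_mono vI (f := pairL i \0).
  by move=> a; apply/vK; rewrite /= linear0 subr0; apply/ip; exists a.
have [|r rE] := factor_mono iI (f := (fst \o v) \- (h \o snd \o v)).
  by move=> z; apply/ip; rewrite /= linearB hE vE subrr.
apply: (@gorenstein_projective_retract V K s r).
  by move=> a; apply: iI; rewrite rE /= sE /= linear0 subr0.
have [|j' j'E] := factor_mono vI (f := pairL \0 j).
  by move=> a; apply/vK; rewrite /= linear0 sub0r (jq _).2 ?oppr0 //; exists a.
apply: (@gorenstein_projective_extension K' V P j' (fst \o v)) => //.
  split=> [x y xy|z|x].
  - by apply: jI; move: (j'E x) (j'E y); rewrite xy => ->; case.
  - split=> [/= z1|[x <-]]; last by rewrite /= j'E.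
    have /jq[x xE] : q (v z).2 = 0 by rewrite -vE z1 linear0.
    by exists x; apply: vI; rewrite j'E /= xE -z1; case: (v z).
  - have [y yE] := qS (p x).
    have /vK[z zE] : copairL p (\- q) (x, y) = 0 by rewrite /= yE subrr.
    by exists z; rewrite /= zE.
exact: projective_gorenstein.
Qed.

(** Embed B in a projective P with Gorenstein projective cokernel. Then P / A is an extension of P /
    B by B / A = C, hence Gorenstein projective, and A is a syzygy of it. *)
Lemma gorenstein_projective_epikernel : epikernel_closed GP.
Proof.
move=> A B C f g [fI fg gS] GB GC.
have [_ _ [P [B' [j [p [projP [jI jp pS] GB']]]]]] :=
  gorenstein_projective_bisyzygetic GB.
have jfI : injective (j \o f) by apply: inj_comp jI fI.
have [D [c cse]] := short_exact_cokernel jfI; have [_ cj cS] := cse.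
apply: (gorenstein_projective_syzygy projP cse).
have [|u uE] := factor_epi (f := c \o j) gS.
  by move=> b /fg[a <-]; apply/cj; exists a.
have [|q qE] := factor_epi (f := p) cS.
  by move=> x /cj[a <-]; apply/jp; exists (f a).
apply: (@gorenstein_projective_extension C D B' u q) => //.
split=> [|d|b]; last by have [x <-] := pS b; exists (c x); rewrite qE.
  apply: mono_of_ker => z; have [b <-] := gS z.
  by rewrite uE => /cj[a /jI <-]; apply/fg; exists a.
have [x <-] := cS d; rewrite qE; split=> [/jp[b <-]|[z]].
  by exists (g b); rewrite uE.
by have [b <-] := gS z; rewrite uE -qE => <-; rewrite qE; apply/jp; exists b.
Qed.

Lemma gorenstein_projective_left_thick : left_thick GP.
Proof.
split; [|exact: gorenstein_projective_extension|exact: gorenstein_projective_epikernel].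
move=> M N N' [f [f' fK f'K]] GM.
have [|s sE] := factor_mono (can_inj fK) (f := pairL idfun (\0 : {linear N -> N'})).
  by move=> x; exists (f' (x, 0)); rewrite f'K.
by apply: (@gorenstein_projective_retract M N s (fst \o f)) => // x; rewrite /= sE.
Qed.

End GorensteinProjective.

(** * Perfect rings and the equivalence *)

(** Since [Ext_vanishes] quantifies over resolutions, one has to be exhibited: a free presentation
    is chosen for every module at once, and [K] is iterated from [X]. *)
Lemma Ext1_vanishes_ext1 (R : pzRingType) (X N : lmodType R) :
  Ext_vanishes 1 X N -> ext1_vanishes X N.
Proof.
have /choice[K] : forall X : lmodType R, exists (K P : lmodType R)
    (i : {linear K -> P}) (p : {linear P -> X}), projective P /\ short_exact i p.
  move=> M; have [p pS] := free_epi M.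
  have [K [i ip]] := short_exact_kernel pS.
  by exists K, (free_mod R M), i, p; split=> //; apply: free_projective.
move=> /choice[P] /dependent_choice_fun[i] /dependent_choice_fun[p] ipP EXN.
have [projP ipE] := (fun M => (ipP M).1, fun M => (ipP M).2).
pose Z n := iter n K X.
pose d n : {linear P (Z n.+1) -> P (Z n)} := i (Z n) \o p (Z n.+1).
have iI M : injective (i M) by case: (ipE M).
have pS M : forall z, exists x, p M x = z by case: (ipE M).
have ip M x : p M x = 0 <-> exists y, i M y = x by case: (ipE M) => _ + _; apply.
have d0 n x : d n x = 0 <-> p (Z n.+1) x = 0.
  by split=> [dx0|/= ->]; [apply: (iI (Z n)); rewrite linear0|rewrite linear0].
have imd n y : (exists x, d n x = y) <-> exists z, i (Z n) z = y.
  split=> [[x <-]|[z <-]]; first by exists (p (Z n.+1) x).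
  by have [x <-] := pS (Z n.+1) z; exists x.
have resX : projective_resolution (P := P \o Z) d (p X).
  split=> [n|n y|y|y].
  - exact: projP.
  - exact: iff_trans (d0 n y) (iff_trans (ip _ y) (iff_sym (imd n.+1 y))).
  - exact: iff_trans (ip X y) (iff_sym (imd 0%N y)).
  - exact: pS.
apply: (ext1_vanishes_presentation (projP X) (ipE X)) => phi.
have [|psi psiE] := (EXN _ _ _ resX (phi \o p (Z 1%N))).1.
  move=> x; rewrite /= (_ : p (Z 1%N) _ = 0) ?linear0 //.
  by apply/ip; exists (p (Z 2%N) x).
exists psi => a; have [x <-] := pS (Z 1%N) a.
exact: (psiE x).
Qed.

Lemma projective_of_split_epi (R : pzRingType) (P M : lmodType R) (s : {linear M -> P})
    (p : {linear P -> M}) :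
  cancel s p -> projective P -> projective M.
Proof.
move=> sK projP A B g f gS; have [h hE] := projP A B g (f \o p) gS.
by exists (h \o s) => x; rewrite /= hE /= sK.
Qed.

Lemma ext1_vanishes_split (R : pzRingType) (K P M : lmodType R) (i : {linear K -> P})
    (p : {linear P -> M}) :
  short_exact i p -> ext1_vanishes M K -> exists s : {linear M -> P}, cancel s p.
Proof.
move=> ip; have [iI ipE pS] := ip => /(_ _ _ _ _ ip idfun)[r rE].
have [|s sE] := factor_epi (f := idfun \- (i \o r)) pS.
  by move=> x /ipE[k <-]; rewrite /= rE subrr.
exists s => m; have [x <-] := pS m.
by rewrite sE /= linearB (short_exact0 _ ip) subr0.
Qed.

Lemma projective_syzygy (R : pzRingType) (K P M : lmodType R) (i : {linear K -> P})
    (p : {linear P -> M}) :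
  projective P -> short_exact i p -> projective M -> projective K.
Proof.
move=> projP ip projM; have [iI ipE pS] := ip.
have [r rE] := ext1_vanishes_projective projM ip (@idfun K).
exact: projective_of_split_epi rE projP.
Qed.

Lemma projective_summand_closed (R : pzRingType) : summand_closed (@projective R).
Proof.
move=> M N N' [f [f' fK f'K]] projM.
have [|s sE] := factor_mono (can_inj fK) (f := pairL idfun (\0 : {linear N -> N'})).
  by move=> x; exists (f' (x, 0)); rewrite f'K.
by apply: (@projective_of_split_epi _ M N s (fst \o f)) => // x; rewrite /= sE.
Qed.

Lemma left_perfect_of_frobenius (R : pzRingType) (L : lmod_class R) :
  left_frobenius_pair (gorenstein_projective L) (@flat R) -> left_perfect R.
Proof.
move=> [_ injF [FGP _] _] M flatM.
have [p pS] := free_epi M.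
have [K [i ip]] := short_exact_kernel pS.
have projF := @free_projective R M.
have flatK := flat_epikernel ip (projective_flat projF) flatM.
have [s sK] := ext1_vanishes_split ip
  (Ext1_vanishes_ext1 (injF M K 1%N isT (FGP M flatM) flatK)).
exact: projective_of_split_epi sK projF.
Qed.

(** Flat and projective now coincide, so flat modules lie in L, and the syzygy and cosyzygy
    sequences of a Gorenstein projective module have flat middle terms. The higher Ext groups are
    shifted down inside GP for injectivity and inside the projectives for projectivity. *)
Lemma frobenius_of_left_perfect (R : pzRingType) (L : lmod_class R) :
    (forall P, projective P -> L P) -> left_perfect R ->
  strong_left_frobenius_pair (gorenstein_projective L) (@flat R).
Proof.
move=> projL perf; have bi := @gorenstein_projective_bisyzygetic R L.
have flatGP M : flat M -> gorenstein_projective L M.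
  by move=> /perf; apply: projective_gorenstein.
split; [split|..].
- exact: gorenstein_projective_left_thick projL.
- move=> M N n n0 GM /perf/projL LN.
  apply: (@Ext_vanishes_of_ext1 _ (gorenstein_projective L) N) n0 GM.
    by move=> X GX; apply: gorenstein_projective_ext1 GX LN.
  by move=> K P X i p; apply: gorenstein_projective_syzygy.
- split=> // M /bi[_ _ [Q [Y [i [p [projQ ip GY]]]]]].
  by exists Q, Y, i, p; split=> //; apply: projective_flat.
- move=> M N N' MN /perf projM; apply: projective_flat.
  exact: projective_summand_closed MN projM.
- move=> M N n n0 _ /perf projN.
  apply: (@Ext_vanishes_of_ext1 _ (@projective R) M) n0 projN.
    by move=> X; apply: ext1_vanishes_projective.
  by move=> K P X i p; apply: projective_syzygy.
- split=> // M /bi[_ [Q [K [i [p [projQ ip GK]]]]] _].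
  by exists K, Q, i, p; split=> //; apply: projective_flat.
Qed.

Theorem proposition3p10 (R : pzRingType)
    (L : lmod_class R) (A : lmod_class R^c)
    (hLA : complete_duality_pair L A) :
  (strong_left_frobenius_pair (gorenstein_projective L) (@flat R) <->
     left_frobenius_pair (gorenstein_projective L) (@flat R)) /\
  (left_frobenius_pair (gorenstein_projective L) (@flat R) <->
     left_perfect R).
Proof.
have weak : strong_left_frobenius_pair (gorenstein_projective L) (@flat R) ->
  left_frobenius_pair (gorenstein_projective L) (@flat R) by case.
have perf := @left_perfect_of_frobenius R L.
have strong := frobenius_of_left_perfect (perfect_pair_projective hLA.1).
split; split=> //; first by move=> /perf/strong.
by move=> /strong/weak.
Qed.
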